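(* Let $r$ be a real root of an irreducible cubic polynomial over $\mathbb{Q}$, and let $s = (\alpha r + \beta)/(\gamma r + \delta)$ and $t = (\alpha' r + \beta')/(\gamma' r + \delta')$ be two irrational elements of $\mathbb{Q}(r)$, each written in standard form. Then $s$ and $t$ have common tails if and only if $|\alpha\delta - \beta\gamma| = |\alpha'\delta' - \beta'\gamma'|$, $\gcd(\alpha, \gamma) = \gcd(\alpha', \gamma')$, and $y(\alpha,\beta,\gamma,\delta) = y(\alpha',\beta',\gamma',\delta')$.
   Context: Irrational real numbers $s = [s_0; s_1, \dots]$ and $t = [t_0; t_1, \dots]$ (simple continued fractions) have common tails if there exist $m, n \ge 0$ with $s_{m+k} = t_{n+k}$ for all $k \ge 0$. Every irrational element of $\mathbb{Q}(r)$ can be written as $(\alpha r + \beta)/(\gamma r + \delta)$ in standard form, meaning $\alpha, \beta, \gamma, \delta$ are integers with no common factor greater than $1$ among all four, and either $\alpha > 0$, or $\alpha = 0$ and $\beta \ge 0$. For such integers, let $\epsilon = \gcd(\alpha, \gamma)$ and $\eta = |\alpha\delta - \beta\gamma|/\epsilon$. Choose integers $p, q$ with $p(\alpha/\epsilon) + q(\gamma/\epsilon) = 1$ and let $y = y(\alpha,\beta,\gamma,\delta)$ be the integer with $0 \le y < \eta$ and $y \equiv p\beta + q\delta \pmod{\eta}$; equivalently, $y$ is the unique integer in $[0, \eta)$ with $y(\alpha/\epsilon) \equiv \beta$ and $y(\gamma/\epsilon) \equiv \delta \pmod{\eta}$. *)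

(* Defs.v *)
From HB Require Import structures.
From mathcomp Require Import all_boot all_order all_algebra.
From mathcomp Require Import all_classical all_reals.
From mathcomp Require Import ring.
Set Implicit Arguments. Unset Strict Implicit. Unset Printing Implicit Defensive.
Import Order.TTheory GRing.Theory Num.Theory.
Local Open Scope ring_scope.

(* Simple continued fractions [x_0; x_1, ...].  For irrational x no complete
   quotient is an integer, so the inverse is never taken at 0. *)
Definition complete_quotient (R : realType) (x : R) (n : nat) : R :=
  iter n (fun z : R => (z - (Num.floor z)%:~R)^-1) x.

Definition partial_quotient (R : realType) (x : R) (n : nat) : int :=
  Num.floor (complete_quotient x n).

Definition common_tails (R : realType) (s t : R) : Prop :=
  exists m n : nat, forall k : nat,
    partial_quotient s (m + k)%N = partial_quotient t (n + k)%N.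

(* x = (a r + b) / (c r + d).  When c r + d = 0 the right-hand side is 0, which
   is excluded as soon as x is irrational. *)
Definition standard_form (R : realType) (r x : R) (a b c d : int) : Prop :=
  [/\ x = (a%:~R * r + b%:~R) / (c%:~R * r + d%:~R),
      gcdz (gcdz a b) (gcdz c d) = 1
    & 0 < a \/ a = 0 /\ 0 <= b].

Definition eps_of (a c : int) : int := gcdz a c.

Definition eta_of (a b c d : int) : int :=
  (`|a * d - b * c| %/ eps_of a c)%Z.

(* The integers p, q are the Bezout coefficients given by egcdz; y_ofE shows
   that any other choice yields the same value. *)
Definition y_of (a b c d : int) : int :=
  let pq := egcdz (a %/ eps_of a c)%Z (c %/ eps_of a c)%Z in
  ((pq.1 * b + pq.2 * d) %% eta_of a b c d)%Z.

Lemma y_ofE (a b c d p q : int) :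
  p * (a %/ eps_of a c)%Z + q * (c %/ eps_of a c)%Z = 1 ->
  y_of a b c d = ((p * b + q * d) %% eta_of a b c d)%Z.
Proof.
rewrite /y_of /eta_of /eps_of; set e := gcdz a c.
set a1 := (a %/ e)%Z; set c1 := (c %/ e)%Z => Dpq.
have Da : a = a1 * e by rewrite divzK // dvdz_gcdl.
have Dc : c = c1 * e by rewrite divzK // dvdz_gcdr.
have g1 : gcdz a1 c1 = 1.
  have : (gcdz a1 c1 %| p * a1 + q * c1)%Z.
    by rewrite rpredD // dvdz_mull // ?dvdz_gcdl ?dvdz_gcdr.
  by rewrite Dpq dvdzE /= dvdn1 /gcdz => /eqP ->.
case: egcdzP => u v; rewrite g1 => Duv _ /=.
have [e0|e0] := eqVneq e 0.
  by move: Dpq; rewrite /a1 /c1 e0 !divz0 !mulr0.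
have De : `|e| = e by rewrite /e /gcdz; case: gcdn.
have -> : a * d - b * c = (a1 * d - b * c1) * e by rewrite {1}Da {1}Dc; ring.
rewrite normrM De mulzK //; apply/eqP; rewrite eqz_mod_dvd.
have -> : u * b + v * d - (p * b + q * d) =
          - (u * q - v * p) * (a1 * d - b * c1).
  rewrite -[u * b + v * d]mulr1 -[p * b + q * d]mulr1 -{1}Dpq -Duv; ring.
by rewrite dvdzE -abszE absz_id -dvdzE dvdz_mull.
Qed.

(* Main.v *)
Require Import Defs.
From mathcomp Require Import all_boot all_order all_algebra.
From mathcomp Require Import all_classical all_reals.
From mathcomp Require Import ring lra zify.
Set Implicit Arguments. Unset Strict Implicit. Unset Printing Implicit Defensive.
Import Order.TTheory GRing.Theory Num.Theory.
Local Open Scope ring_scope.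

(* Serret's theorem: s and t have common tails iff s = (A t + B) / (C t + D) with
   A D - B C = 1 or -1.  Since r is cubic, 1, r and r^2 are linearly independent
   over Q, so for s = M r and t = M' r with primitive integer matrices M and M'
   such a relation forces M = U M' with U in GL_2(Z).  Left multiplication by
   GL_2(Z) is classified by the Hermite normal form: that of (a b; c d) is
   (eps y; 0 eta). *)

(** * Irrational numbers and complete quotients *)

Section Irrational.
Variable R : realType.
Implicit Types x y : R.

Lemma irrational_linear_eq0 x (u v : int) :
  irrational x -> u%:~R * x = v%:~R -> u = 0 /\ v = 0.
Proof.
move=> xirr uxv; have u0 : u = 0.
  apply: contra_notP xirr => /eqP u_neq0.
  exists (v%:~R / u%:~R) => //; rewrite fmorph_div /= !ratr_int -uxv mulrC mulKf //.
  by rewrite intr_eq0.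
by split=> //; apply/eqP; rewrite -(intr_eq0 R) -uxv u0 mul0r.
Qed.

(** A rational value u/v of [y] would give an integer linear relation on [x]; its coefficients
    vanish, which forces [v * (a * d - b * c) = 0]. The relation between [x] and [y] is kept free of
    division, so that no denominator has to be shown nonzero beforehand. *)
Lemma irrational_mobius x y (a b c d : int) :
  irrational x -> a * d - b * c != 0 ->
  y * (c%:~R * x + d%:~R) = a%:~R * x + b%:~R -> irrational y.
Proof.
move=> xirr det0 yx [q _ qy]; move: yx; rewrite -{}qy.
rewrite -[q]divq_num_den fmorph_div /= !ratr_int.
have := denq_neq0 q; rewrite -(intr_eq0 R); move: (numq q) (denq q) => u v v0 H.
have [/eqP e1 /eqP e2] : u * c - v * a = 0 /\ v * b - u * d = 0.
  apply: (irrational_linear_eq0 xirr).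
  rewrite !rmorphB !rmorphM /=; move: H; rewrite mulrAC => /(canRL (mulfVK v0)) H.
  have -> : (u%:~R * c%:~R - v%:~R * a%:~R) * x =
    u%:~R * (c%:~R * x + d%:~R) - v%:~R * a%:~R * x - u%:~R * d%:~R by ring.
  by rewrite H; ring.
have : v * (a * d - b * c) = 0.
  move: e1 e2; rewrite !subr_eq0 => /eqP e1 /eqP e2.
  by rewrite mulrBr !mulrA -e1 e2; ring.
by move/eqP; rewrite mulf_eq0 (negPf det0) orbF -(intr_eq0 R) (negPf v0).
Qed.

Lemma irrational_neq_int x (n : int) : irrational x -> x != n%:~R.
Proof.
move=> xirr; apply/eqP => xn.
by have [] := @irrational_linear_eq0 x 1 n xirr; rewrite ?mul1r.
Qed.

Lemma irrational_opp x : irrational x -> irrational (- x).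
Proof. by move=> xirr; apply: (@irrational_mobius x _ (-1) 0 0 1) => //; ring. Qed.

Lemma irrational_addz x (n : int) : irrational x -> irrational (x + n%:~R).
Proof.
move=> xirr; apply: (@irrational_mobius x _ 1 n 0 1) => //; last by ring.
by rewrite mulr0 subr0.
Qed.

Lemma irrational_inv x : irrational x -> irrational x^-1.
Proof.
move=> xirr; apply: (@irrational_mobius x _ 0 1 1 0) => //.
rewrite addr0 mul1r mul0r add0r mulVf //; exact: (irrational_neq_int 0).
Qed.

Lemma irrational_fract x : irrational x -> 0 < x - (Num.floor x)%:~R < 1.
Proof.
move=> xirr; have /andP[] := floor_itv x; rewrite rmorphD /= => lex ltx.
rewrite subr_gt0 lt_neqAle eq_sym irrational_neq_int // lex /=; lra.
Qed.

Lemma irrational_complete_quotient x n :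
  irrational x -> irrational (complete_quotient x n).
Proof.
move=> xirr; elim: n => //= n IHn; apply: irrational_inv.
by rewrite -mulrNz; apply: irrational_addz.
Qed.

Lemma complete_quotient_gt1 x n :
  irrational x -> 1 < complete_quotient x n.+1.
Proof.
move=> /(@irrational_complete_quotient x n) /irrational_fract /andP[gt0 lt1].
by rewrite /= invf_gt1.
Qed.

Lemma complete_quotientD x m k :
  complete_quotient x (m + k) = complete_quotient (complete_quotient x m) k.
Proof. by rewrite /complete_quotient addnC iterD. Qed.

Lemma complete_quotient_step x n : irrational x ->
  complete_quotient x n =
  (partial_quotient x n)%:~R + (complete_quotient x n.+1)^-1.
Proof. by move=> xirr; rewrite /= invrK addrC subrK. Qed.

End Irrational.

(** * Serret's theorem *)

Section TailEquiv.
Variable R : realType.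
Implicit Types s t u x y : R.

(** A single equality of complete quotients is easy to compose. For irrational numbers it agrees
    with [common_tails], since partial quotients determine the number. *)
Definition tail_equiv s t :=
  exists m n, complete_quotient s m = complete_quotient t n.

Lemma tail_equiv_common_tails s t : tail_equiv s t -> common_tails s t.
Proof.
move=> [m [n mn]]; exists m, n => k.
by rewrite /partial_quotient !complete_quotientD mn.
Qed.

Lemma tail_equiv_refl t : tail_equiv t t.
Proof. by exists 0%N, 0%N. Qed.

Lemma tail_equiv_sym s t : tail_equiv s t -> tail_equiv t s.
Proof. by move=> [m [n mn]]; exists n, m. Qed.

Lemma tail_equiv_trans t s u :
  tail_equiv s t -> tail_equiv t u -> tail_equiv s u.
Proof.
move=> [m [n mn]] [m' [n' mn']]; exists (m + m')%N, (n' + n)%N.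
by rewrite !complete_quotientD mn -mn' -!complete_quotientD addnC.
Qed.

Lemma tail_equiv_addz t (k : int) : tail_equiv (t + k%:~R) t.
Proof.
exists 1%N, 1%N => /=; rewrite floorDrz ?intr_int // rmorphD /= intrKfloor.
by congr _^-1; ring.
Qed.

Lemma tail_equiv_subz t (k : int) : tail_equiv (t - k%:~R) t.
Proof. by rewrite -mulrNz; apply: tail_equiv_addz. Qed.

(** Here t = [0; 1/t], so 1/t is the complete quotient of t of index 1. *)
Lemma tail_equiv_inv01 t : 0 < t < 1 -> tail_equiv t^-1 t.
Proof.
move=> /andP[t0 t1]; exists 0%N, 1%N => /=.
by rewrite (@floor_def _ t 0) ?subr0 // add0r t1 ltW.
Qed.

Lemma tail_equiv_inv_gt0 t : irrational t -> 0 < t -> tail_equiv t^-1 t.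
Proof.
move=> tirr t0; have [lt1|lt1|t1] := ltgtP t 1.
- by apply: tail_equiv_inv01; rewrite t0.
- apply: tail_equiv_sym; rewrite -{1}[t]invrK; apply: tail_equiv_inv01.
  by rewrite invr_gt0 t0 invf_lt1.
- by have := irrational_neq_int 1 tirr; rewrite t1 eqxx.
Qed.

(* For [0 < t < 1/2], [1 - t = [0; 1, 1/t - 1]]. *)
Lemma tail_equiv_1sub t : irrational t -> 0 < t < 2^-1 -> tail_equiv (1 - t) t.
Proof.
move=> tirr /andP[t0 t2].
have u0 : 0 < 1 - t by lra.
have u1 : 0 < (1 - t)^-1 - 1 < 1.
  have u2 : (1 - t)^-1 < 2 by rewrite -[ltRHS]invrK ltf_pV2 ?posrE ?invr_gt0 //; lra.
  by rewrite subr_gt0 invf_gt1 //; apply/andP; split; lra.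
have uV : ((1 - t)^-1 - 1)^-1 = t^-1 - 1.
  have t_neq0 : t != 0 by rewrite gt_eqF.
  have u_neq0 : 1 - t != 0 by rewrite gt_eqF.
  have -> : (1 - t)^-1 - 1 = t / (1 - t) by field.
  by field; rewrite t_neq0.
apply: (@tail_equiv_trans (1 - t)^-1).
  by apply/tail_equiv_sym/tail_equiv_inv01; rewrite u0; lra.
apply: (@tail_equiv_trans ((1 - t)^-1 - 1)).
  exact/tail_equiv_sym/(tail_equiv_subz _ 1).
apply: (@tail_equiv_trans ((1 - t)^-1 - 1)^-1).
  exact/tail_equiv_sym/tail_equiv_inv01.
rewrite uV; apply: (tail_equiv_trans (tail_equiv_subz _ 1)).
by apply: tail_equiv_inv_gt0.
Qed.

(** Up to integer translation this compares 1 - u with u, for u the fractional part of t;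
    [tail_equiv_1sub] is applied to the smaller of the two. *)
Lemma tail_equiv_opp t : irrational t -> tail_equiv (- t) t.
Proof.
move=> tirr; set u := t - (Num.floor t)%:~R.
have uirr : irrational u by rewrite /u -mulrNz; apply: irrational_addz.
have /andP[u0 u1] : 0 < u < 1 := irrational_fract tirr.
have ut : tail_equiv u t := tail_equiv_subz t (Num.floor t).
have Nut : tail_equiv (1 - u) (- t).
  have -> : 1 - u = - t + (1 + Num.floor t)%:~R by rewrite /u rmorphD /=; ring.
  exact: tail_equiv_addz.
apply: tail_equiv_trans (tail_equiv_sym Nut) _; apply: tail_equiv_trans ut.
have [u2|u2|u2] := ltgtP u 2^-1.
- by apply: tail_equiv_1sub; rewrite ?u0.
- rewrite -{2}[u](subKr 1); apply/tail_equiv_sym/tail_equiv_1sub.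
    by rewrite addrC -[1]/(1%:~R); apply/irrational_addz/irrational_opp.
  lra.
- have -> : 1 - u = u by rewrite u2; field.
  exact: tail_equiv_refl.
Qed.

Lemma tail_equiv_inv t : irrational t -> tail_equiv t^-1 t.
Proof.
move=> tirr; have [t0|t0|t0] := ltgtP t 0.
- apply: (@tail_equiv_trans (- t)); last exact: tail_equiv_opp.
  have Ntirr := irrational_opp tirr.
  apply: (@tail_equiv_trans (- t)^-1); last by apply: tail_equiv_inv_gt0; rewrite ?oppr_gt0.
  rewrite invrN; apply/tail_equiv_sym/tail_equiv_opp; exact: irrational_inv.
- exact: tail_equiv_inv_gt0.
- by rewrite t0 invr0; apply: tail_equiv_refl.
Qed.

End TailEquiv.

(** * Unimodular transformations and common tails *)

Section Serret.
Variable R : realType.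
Implicit Types s t x y : R.

Lemma sqr_eq1_int_neq0 (z : int) : z ^+ 2 = 1 -> z != 0.
Proof. by apply: contra_eq_neq => ->. Qed.

(** This is the Euclidean algorithm on the first column (a, c): subtracting the quotient [q] from y
    and inverting turns the column into (c, a mod c). The lower left entry shrinks until it is 0,
    and then y is x or -x up to an integer. *)
Lemma tail_equiv_unimodular x y (a b c d : int) :
  irrational x -> (a * d - b * c) ^+ 2 = 1 ->
  y * (c%:~R * x + d%:~R) = a%:~R * x + b%:~R -> tail_equiv y x.
Proof.
have [n] := ubnP `|c|%N; elim: n => // n IHn in x y a b c d * => cn xirr det1 yx.
have yirr := irrational_mobius xirr (sqr_eq1_int_neq0 det1) yx.
have [c0|c_neq0] := eqVneq c 0.
  move: det1 yx; rewrite c0 mulr0 subr0 mul0r add0r => ad2 yx.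
  have d2 : d * d = 1.
    have : (d %| (a * d) ^+ 2)%Z by rewrite expr2 mulrA dvdz_mull.
    by rewrite ad2 dvdz1; case: (d) => [] [|[|]].
  have /orP ad : (a * d == 1) || (a * d == -1) by rewrite -sqrf_eq1 ad2.
  (* As d is its own inverse, multiplying [y * d] by d solves for y. *)
  have -> : y = (a * d)%:~R * x + (b * d)%:~R.
    have dd : (d%:~R * d%:~R : R) = 1.
      by rewrite -rmorphM /= d2.
    transitivity (y * (d%:~R * d%:~R)); first by rewrite dd mulr1.
    by rewrite mulrA yx !rmorphM /=; ring.
  apply: tail_equiv_trans (tail_equiv_addz _ _) _.
  case: ad => /eqP ->; rewrite ?mul1r; first exact: tail_equiv_refl.
  by rewrite rmorphN mulN1r; apply: tail_equiv_opp.
set q := (a %/ c)%Z.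
have aE : a = q * c + (a %% c)%Z := divz_eq a c.
apply: tail_equiv_trans (tail_equiv_sym (tail_equiv_subz y q)) _.
have y'irr : irrational (y - q%:~R) by rewrite -mulrNz; apply: irrational_addz.
apply: tail_equiv_trans (tail_equiv_sym (tail_equiv_inv y'irr)) _.
apply: (IHn x _ c d (a %% c)%Z (b - q * d)) => //.
- by have := ltz_mod a c_neq0; have := modz_ge0 a c_neq0; lia.
- rewrite -det1 {2}aE; ring.
- have y'_neq0 : y - q%:~R != 0 := irrational_neq_int 0 y'irr.
  have a'E : (a %% c)%Z = a - q * c by rewrite {2}aE; ring.
  rewrite a'E !rmorphB !rmorphM /= -[RHS](mulKf y'_neq0); congr (_ * _).
  by rewrite [RHS]mulrBl yx; ring.
Qed.

(** The matrix is the product of the (f 1; 1 0) over the first n partial quotients f, the matrix of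
    convergents. Each factor has determinant -1, so only the square of the determinant is
    tracked. *)
Lemma complete_quotient_unimodular x n : irrational x ->
  exists a b c d : int, (a * d - b * c) ^+ 2 = 1 /\
    x * (c%:~R * complete_quotient x n + d%:~R) =
    a%:~R * complete_quotient x n + b%:~R.
Proof.
move=> xirr; elim: n => [|n [a [b [c [d [det1 IHn]]]]]].
  by exists 1, 0, 0, 1; split=> //=; ring.
set f := partial_quotient x n.
exists (a * f + b), a, (c * f + d), c; split; first by rewrite -det1; ring.
move: IHn; rewrite (complete_quotient_step n xirr) -/f.
have z_neq0 := irrational_neq_int 0 (@irrational_complete_quotient _ _ n.+1 xirr).
set z := complete_quotient x n.+1 in z_neq0 * => IHn.
have /(congr1 ( *%R^~ z)) := IHn.
rewrite -mulrA !mulrDl -!mulrA !mulrDl mulVf // !rmorphD !rmorphM /= => e.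
transitivity (x * (c%:~R * (f%:~R * z + 1) + d%:~R * z)); first by ring.
by rewrite e; ring.
Qed.

(** One step with equal floors scales the distance by x1 * y1, which may be arbitrarily close to 1.
    Two steps scale it by (x1 * x2) * (y1 * y2), and x1 * x2 = a1 * x2 + 1 is at least 2 because a1
    >= 1 and x2 > 1. *)
Lemma same_quotients_contract x y : irrational x -> irrational y ->
  (forall k, partial_quotient x k = partial_quotient y k) ->
  `|x - y| * 4 <= `|complete_quotient x 2%N - complete_quotient y 2%N|.
Proof.
move=> xirr yirr xy.
have prod_ge2 (z : R) : irrational z ->
    2 <= complete_quotient z 1%N * complete_quotient z 2%N.
  move=> zirr; have gt1 := complete_quotient_gt1 0%N zirr.
  rewrite (complete_quotient_step 1%N zirr) mulrDl mulVf; last first.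
    exact/(irrational_neq_int 0)/irrational_complete_quotient.
  have : (1 : R) <= (partial_quotient z 1%N)%:~R.
    by rewrite (ler_int R 1) /partial_quotient floor_ge_int ltW.
  have := complete_quotient_gt1 1%N zirr; nra.
have Px := prod_ge2 x xirr; have Py := prod_ge2 y yirr.
have -> : complete_quotient x 2%N - complete_quotient y 2%N =
    (x - y) * ((complete_quotient x 1%N * complete_quotient x 2%N) *
               (complete_quotient y 1%N * complete_quotient y 2%N)).
  have n0 (z : R) k : irrational z -> complete_quotient z k != 0.
    by move=> zirr; exact/(irrational_neq_int 0)/irrational_complete_quotient.
  have := complete_quotient_step 0%N xirr; have := complete_quotient_step 0%N yirr.
  have := complete_quotient_step 1%N xirr; have := complete_quotient_step 1%N yirr.
  rewrite -(xy 0%N) -(xy 1%N) -[complete_quotient x 0%N]/x -[complete_quotient y 0%N]/y.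
  move: (n0 x 1%N xirr) (n0 x 2%N xirr) (n0 y 1%N yirr) (n0 y 2%N yirr).
  set x1 := complete_quotient x 1%N; set x2 := complete_quotient x 2%N.
  set y1 := complete_quotient y 1%N; set y2 := complete_quotient y 2%N.
  move=> x1n x2n y1n y2n ey1 ex1 ey ex.
  have -> : x - y = x1^-1 - y1^-1 by lra.
  transitivity ((y1 - x1) * (x2 * y2)); last by field; rewrite x1n y1n.
  by rewrite ex1 ey1; field; rewrite x2n y2n.
by rewrite normrM ler_wpM2l // ger0_norm; nra.
Qed.

(** Equal floors put x and y within distance 1, and the same holds for all later complete quotients;
    pulling this bound back through 2n steps gains a factor 4^n. *)
Lemma partial_quotients_inj x y : irrational x -> irrational y ->
  (forall k, partial_quotient x k = partial_quotient y k) -> x = y.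
Proof.
move=> xirr yirr xy; apply/eqP; rewrite -subr_eq0 -normr_eq0; apply: contraT => xy0.
have le1 n : `|x - y| * 4 ^+ n <= 1.
  elim: n => [|n IHn] in x y xirr yirr xy {xy0} *.
    have /andP[] := irrational_fract xirr; have /andP[] := irrational_fract yirr.
    by have /= := xy 0%N; rewrite /partial_quotient /= => ->; rewrite mulr1 ler_norml; lra.
  rewrite exprS mulrA.
  have le2 : `|complete_quotient x 2%N - complete_quotient y 2%N| * 4 ^+ n <= 1.
    apply: IHn => [||k]; try exact: irrational_complete_quotient.
    by have := xy (2 + k)%N; rewrite /partial_quotient !complete_quotientD.
  by apply: le_trans le2; rewrite ler_wpM2r ?exprn_ge0 // same_quotients_contract.
(* The Archimedean property: some power of 2, hence of 4, exceeds the inverse of the distance. *)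
have := @upper_nthrootP R `|x - y|^-1 _ (leqnn _).
set n := Num.bound _ => ltn.
have : `|x - y|^-1 < 4 ^+ n by apply: lt_le_trans ltn _; rewrite lerXn2r ?nnegrE //; lra.
have xy_gt0 : 0 < `|x - y| by rewrite lt_def xy0 normr_ge0.
by rewrite -div1r ltr_pdivrMr // mulrC ltNge le1.
Qed.

Lemma common_tails_unimodular s t : irrational s -> irrational t ->
  common_tails s t ->
  exists a b c d : int, (a * d - b * c) ^+ 2 = 1 /\
    s * (c%:~R * t + d%:~R) = a%:~R * t + b%:~R.
Proof.
move=> sirr tirr [m [n mn]].
have eq_cq : complete_quotient s m = complete_quotient t n.
  apply: partial_quotients_inj; try exact: irrational_complete_quotient.
  by move=> k; have := mn k; rewrite /partial_quotient !complete_quotientD.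
have [a [b [c [d [det1]]]]] := complete_quotient_unimodular m sirr.
have [a' [b' [c' [d' [det1']]]]] := complete_quotient_unimodular n tirr.
rewrite eq_cq; set z := complete_quotient t n => tz sz.
(* The entries of (a b; c d) times the adjugate of (a' b'; c' d'). *)
exists (a * d' - b * c'), (b * a' - a * b'), (c * d' - d * c'), (d * a' - c * b').
split; first by rewrite -[RHS]mulr1 -{1}det1 -det1'; ring.
have zt : z * (a'%:~R - c'%:~R * t) = d'%:~R * t - b'%:~R.
  have -> : z * (a'%:~R - c'%:~R * t) =
    (a'%:~R * z + b'%:~R) - t * (c'%:~R * z + d'%:~R) + d'%:~R * t - b'%:~R by ring.
  by rewrite tz; ring.
have /(congr1 ( *%R^~ (a'%:~R - c'%:~R * t))) := sz.
rewrite -mulrA !mulrDl -!mulrA zt !rmorphB !rmorphM /= => e.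
transitivity (s * (c%:~R * (d'%:~R * t - b'%:~R) + d%:~R * (a'%:~R - c'%:~R * t))).
  by ring.
by rewrite e; ring.
Qed.

End Serret.

(** * Hermite normal form *)

Lemma irreducible_root_eq0 (R : realType) (f g : {poly rat}) (r : R) :
  irreducible_poly f -> root (map_poly ratr f) r ->
  (size g < size f)%N -> root (map_poly ratr g) r -> g = 0.
Proof.
move=> f_irr fr gf gr; apply/eqP; apply: contraT => g0.
(* A nonzero g of smaller degree is coprime to f; evaluating a Bezout identity at the common root r
   then yields a nonzero constant equal to 0. *)
have : coprimep f g.
  by rewrite irreducible_poly_coprime //; apply: contraL gf => /(dvdp_leq g0); rewrite -leqNgt.
move/Bezout_coprimepP => [[u v] /= /eqpf_eq [k k0 /(congr1 (map_poly (@ratr R)))]].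
move/(congr1 (horner^~ r)); rewrite rmorphD !rmorphM /= linearZ /= rmorph1 !hornerE.
rewrite (eqP fr) (eqP gr) !mulr0 addr0 => /esym/eqP.
by rewrite fmorph_eq0 (negPf k0).
Qed.

Lemma cubic_root_free (R : realType) (f : {poly rat}) (r : R) (u v w : int) :
  size f = 4%N -> irreducible_poly f -> root (map_poly ratr f) r ->
  u%:~R * r ^+ 2 + v%:~R * r + w%:~R = 0 -> [/\ u = 0, v = 0 & w = 0].
Proof.
move=> f4 f_irr fr uvw.
have g0 : \poly_(i < 3) nth 0 [:: w%:~R; v%:~R; u%:~R] i = 0 :> {poly rat}.
  apply: (irreducible_root_eq0 f_irr fr); first by rewrite f4 ltnS size_poly.
  rewrite /root -uvw poly_def !big_ord_recr big_ord0 /= !rmorphD rmorph0 /=.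
  rewrite !linearZ /= !map_polyXn !hornerE /= !ratr_int ?expr0 ?expr1.
  by apply/eqP; ring.
have int0 (z : int) : z%:~R = 0 :> rat -> z = 0 by move/eqP; rewrite intr_eq0 => /eqP.
have g_coef i : (i < 3)%N -> nth 0 [:: w%:~R; v%:~R; u%:~R] i = 0 :> rat.
  by move=> i3; have := congr1 (fun h : {poly rat} => h`_i) g0; rewrite coef_poly i3 coef0.
by split; apply: int0; [apply: (g_coef 2%N) | apply: (g_coef 1%N) | apply: (g_coef 0%N)].
Qed.

(* With [M = (a b; c d)] and [P = (A B; C D)], the three equations say that
   [adj M * P] is a scalar matrix [k], so [det M * P = k * M], and primitivity
   of [M] makes [det M] divide [k]. *)
Lemma primitive_proportional (a b c d A B C D : int) :
  gcdz (gcdz a b) (gcdz c d) = 1 -> a * d - b * c != 0 ->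
  a * C = c * A -> b * D = d * B -> a * D + b * C = A * d + B * c ->
  exists l, [/\ A = l * a, B = l * b, C = l * c & D = l * d].
Proof.
move=> prim det0 eac ebd emid; set k := d * A - b * C.
have kE : k = a * D - c * B by rewrite /k; lia.
have eA : (a * d - b * c) * A = k * a.
  by transitivity (a * d * A - b * (c * A)); [ring | rewrite -eac /k; ring].
have eB : (a * d - b * c) * B = k * b.
  by transitivity (a * (d * B) - b * c * B); [ring | rewrite -ebd kE; ring].
have eC : (a * d - b * c) * C = k * c.
  by transitivity (d * (a * C) - b * c * C); [ring | rewrite eac /k; ring].
have eD : (a * d - b * c) * D = k * d.
  by transitivity (a * d * D - c * (b * D)); [ring | rewrite ebd kE; ring].
have : (a * d - b * c %| k * gcdz (gcdz a b) (gcdz c d))%Z.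
  have [u [v <-]] := Bezoutz (gcdz a b) (gcdz c d).
  have [u1 [v1 <-]] := Bezoutz a b; have [u2 [v2 <-]] := Bezoutz c d.
  have -> : k * (u * (u1 * a + v1 * b) + v * (u2 * c + v2 * d)) =
    (k * a) * (u * u1) + (k * b) * (u * v1) + (k * c) * (v * u2) + (k * d) * (v * v2).
    by ring.
  by rewrite -eA -eB -eC -eD -!mulrA -!mulrDr dvdz_mulr.
rewrite prim mulr1 => /dvdzP[l kl]; exists l.
by split; apply: (mulfI det0); rewrite ?eA ?eB ?eC ?eD kl; ring.
Qed.

(** * Invariance under left multiplication by GL_2(Z) *)

Lemma eqz_of_dvdz (m n : int) : (m %| n)%Z -> (n %| m)%Z -> `|m| = `|n|.
Proof.
rewrite !dvdzE => mn nm; apply: (congr1 Posz); apply/eqP.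
by rewrite eqn_dvd mn nm.
Qed.

Lemma gcdz_norm (m n : int) : `|gcdz m n| = gcdz m n.
Proof. by []. Qed.

Lemma dvdz_gcdz_comb (m n u v : int) : (gcdz m n %| u * m + v * n)%Z.
Proof. by rewrite rpredD // dvdz_mull ?dvdz_gcdl ?dvdz_gcdr. Qed.

Lemma bezoutz_div_gcdz (a c u v : int) : gcdz a c != 0 ->
  u * a + v * c = gcdz a c ->
  u * (a %/ gcdz a c)%Z + v * (c %/ gcdz a c)%Z = 1.
Proof.
move=> e0 uv; apply: (mulIf e0).
by rewrite mulrDl -!mulrA !divzK ?dvdz_gcdl ?dvdz_gcdr // mul1r.
Qed.

(** The determinant changes by a sign, and the two first columns are integer combinations of each
    other. For y, a Bezout pair for (a, c) is carried to one for (a', c') giving the same value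
    before reduction; [y_ofE] allows any such pair. *)
Lemma unimodular_invariants (A B C D a b c d a' b' c' d' : int) :
  (A * D - B * C) ^+ 2 = 1 -> gcdz a c != 0 ->
  a = A * a' + B * c' -> b = A * b' + B * d' ->
  c = C * a' + D * c' -> d = C * b' + D * d' ->
  [/\ `|a * d - b * c| = `|a' * d' - b' * c'|,
      gcdz a c = gcdz a' c'
    & y_of a b c d = y_of a' b' c' d'].
Proof.
move=> det1 e0 aE bE cE dE.
have norm1 : `|A * D - B * C| = 1.
  by apply/eqP; rewrite -(@sqrp_eq1 _ _ (normr_ge0 _)) real_normK ?num_real ?det1.
have detE : `|a * d - b * c| = `|a' * d' - b' * c'|.
  by rewrite -[RHS]mul1r -norm1 -normrM aE bE cE dE; congr (`|_|); ring.
have gcdE : gcdz a c = gcdz a' c'.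
  rewrite -gcdz_norm -(gcdz_norm a'); apply: eqz_of_dvdz; rewrite dvdz_gcd.
    (* Since the determinant squares to 1, the inverse matrix is the determinant times the
       adjugate. *)
    have -> : a' = ((A * D - B * C) * D) * a + (- (A * D - B * C) * B) * c.
      by rewrite -[LHS]mul1r -det1 aE cE; ring.
    have -> : c' = (- (A * D - B * C) * C) * a + ((A * D - B * C) * A) * c.
      by rewrite -[LHS]mul1r -det1 aE cE; ring.
    by rewrite !dvdz_gcdz_comb.
  by rewrite aE cE !dvdz_gcdz_comb.
split=> //; have [u [v uv]] := Bezoutz a c.
have bez := bezoutz_div_gcdz e0 uv.
(* The row (u v) times (A B; C D). *)
have bez' : (u * A + v * C) * (a' %/ gcdz a' c')%Z +
            (u * B + v * D) * (c' %/ gcdz a' c')%Z = 1.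
  by apply: bezoutz_div_gcdz; rewrite -gcdE // -uv aE cE; ring.
rewrite (y_ofE b d bez) (y_ofE b' d' bez') /eta_of /eps_of detE gcdE.
by congr (_ %% _)%Z; rewrite bE dE; ring.
Qed.

(** * Standard forms and their Hermite reduction *)

Section StandardForm.
Variable R : realType.
Implicit Types r s t : R.

Lemma standard_form_denom r s (a b c d : int) :
  irrational s -> standard_form r s a b c d -> c%:~R * r + d%:~R != 0.
Proof.
move=> sirr [sE _ _]; apply: contra_not_neq sirr => den0.
by exists 0 => //; rewrite sE den0 invr0 mulr0 rmorph0.
Qed.

Lemma standard_form_mul r s (a b c d : int) :
  irrational s -> standard_form r s a b c d ->
  s * (c%:~R * r + d%:~R) = a%:~R * r + b%:~R.
Proof.
by move=> sirr sf; have := standard_form_denom sirr sf; case: sf => -> _ _ den; rewrite divfK.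
Qed.

(** If the determinant were 0, cancelling the denominator would give c s = a and d s = b;
    irrationality of s then forces c = d = 0, so the denominator itself would vanish. *)
Lemma standard_form_det r s (a b c d : int) :
  irrational s -> standard_form r s a b c d -> a * d - b * c != 0.
Proof.
move=> sirr sf; have den := standard_form_denom sirr sf.
have sE := standard_form_mul sirr sf; apply/eqP => det0.
have det0R : a%:~R * d%:~R = b%:~R * c%:~R :> R.
  by rewrite -!rmorphM /=; congr _%:~R; apply/eqP; rewrite -subr_eq0 det0.
have [c0 _] : c = 0 /\ a = 0.
  apply: (irrational_linear_eq0 sirr); apply: (mulIf den).
  by rewrite -mulrA sE; ring: det0R.
have [d0 _] : d = 0 /\ b = 0.
  apply: (irrational_linear_eq0 sirr); apply: (mulIf den).
  by rewrite -mulrA sE; ring: det0R.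
by move: den; rewrite c0 d0 mul0r addr0 eqxx.
Qed.

Lemma gcdz_neq0_det (a b c d : int) : a * d - b * c != 0 -> gcdz a c != 0.
Proof.
apply: contra_neq => /eqP; rewrite gcdz_eq0 => /andP[/eqP-> /eqP->].
by rewrite mul0r mulr0 subr0.
Qed.

(* [(p q; -c/e a/e)] is unimodular and brings [(a b; c d)] to the Hermite form
   [(e p*b+q*d; 0 det/e)]. *)
Lemma tail_equiv_hermite r s (a b c d p q : int) :
  irrational s -> standard_form r s a b c d ->
  p * (a %/ gcdz a c)%Z + q * (c %/ gcdz a c)%Z = 1 ->
  tail_equiv (((gcdz a c)%:~R * r + (p * b + q * d)%:~R) /
              ((a * d - b * c) %/ gcdz a c)%Z%:~R) s.
Proof.
move=> sirr sf; have det0 := standard_form_det sirr sf.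
have den := standard_form_denom sirr sf.
have sE := standard_form_mul sirr sf.
have e0 := gcdz_neq0_det det0.
have := divzK (dvdz_gcdl a c); have := divzK (dvdz_gcdr a c).
move: (gcdz a c) e0 => e e0.
move: (a %/ e)%Z (c %/ e)%Z => a1 c1 cE aE bez.
have detE : a * d - b * c = (a1 * d - b * c1) * e by rewrite -aE -cE; ring.
rewrite detE mulzK //.
have D0 : a1 * d - b * c1 != 0 by apply: contra_neq det0 => D0; rewrite detE D0 mul0r.
apply: (@tail_equiv_unimodular _ _ _ p q (- c1) a1) => //.
  by rewrite -[RHS](expr1n _ 2) -bez; congr (_ ^+ _); ring.
apply: (mulIf den); apply: (@mulIf _ (a1 * d - b * c1)%:~R); first by rewrite intr_eq0.
rewrite -!mulrA.
transitivity ((e%:~R * r + (p * b + q * d)%:~R) *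
  (- c1%:~R * (s * (c%:~R * r + d%:~R)) + a1%:~R * (c%:~R * r + d%:~R)) *
  ((a1 * d - b * c1)%:~R^-1 * (a1 * d - b * c1)%:~R)).
  by rewrite rmorphN; ring.
rewrite mulVf ?intr_eq0 // sE -aE -cE !rmorphB !rmorphD !rmorphM /=.
transitivity ((p%:~R * (s * (c%:~R * r + d%:~R)) + q%:~R * (c%:~R * r + d%:~R)) *
  (a1%:~R * d%:~R - b%:~R * c1%:~R)); last by rewrite -cE rmorphM /=; ring.
have bezR : p%:~R * a1%:~R + q%:~R * c1%:~R = 1 :> R.
  by rewrite -!rmorphM -rmorphD /= bez.
have -> : e%:~R * r = (p%:~R * a1%:~R + q%:~R * c1%:~R) * (e%:~R * r).
  by rewrite bezR mul1r.
by rewrite sE -aE -cE !rmorphM /=; ring.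
Qed.

End StandardForm.

(** * The two implications for a cubic root *)

Lemma cubic_root_irrational (R : realType) (f : {poly rat}) (r : R) :
  size f = 4%N -> irreducible_poly f -> root (map_poly ratr f) r -> irrational r.
Proof.
move=> f4 f_irr fr [q _ qr].
have [//| _ /eqP] := @cubic_root_free R f r 0 (denq q) (- numq q) f4 f_irr fr.
  rewrite mul0r add0r -qr -{2}[q]divq_num_den fmorph_div /= !ratr_int.
  by rewrite mulrC divfK ?rmorphN ?subrr // intr_eq0 denq_neq0.
by rewrite (negPf (denq_neq0 q)).
Qed.

Lemma common_tails_invariants (R : realType) (f : {poly rat}) (r s t : R)
    (a b c d a' b' c' d' : int) :
  size f = 4%N -> irreducible_poly f -> root (map_poly ratr f) r ->
  irrational s -> irrational t ->
  standard_form r s a b c d -> standard_form r t a' b' c' d' ->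
  common_tails s t ->
  [/\ `|a * d - b * c| = `|a' * d' - b' * c'|,
      gcdz a c = gcdz a' c'
    & y_of a b c d = y_of a' b' c' d'].
Proof.
move=> f4 f_irr fr sirr tirr ss tt /(common_tails_unimodular sirr tirr).
move=> [A [B [C [D [det1 sE]]]]].
have sden := standard_form_denom sirr ss; have tden := standard_form_denom tirr tt.
have sM := standard_form_mul sirr ss; have tM := standard_form_mul tirr tt.
have det0 := standard_form_det sirr ss.
(* P = U M' with U = (A B; C D) and M' = (a' b'; c' d'); both P and M = (a b; c d) send r to s. *)
pose Pa := A * a' + B * c'; pose Pb := A * b' + B * d'.
pose Pc := C * a' + D * c'; pose Pd := C * b' + D * d'.
have sP : s * (Pc%:~R * r + Pd%:~R) = Pa%:~R * r + Pb%:~R.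
  have /(congr1 ( *%R^~ (c'%:~R * r + d'%:~R))) := sE.
  rewrite -mulrA !mulrDl -!mulrA tM => e; rewrite !rmorphD !rmorphM /=.
  transitivity (s * (C%:~R * (a'%:~R * r + b'%:~R) + D%:~R * (c'%:~R * r + d'%:~R))).
    by ring.
  by rewrite e; ring.
have quad : (a%:~R * r + b%:~R) * (Pc%:~R * r + Pd%:~R) =
            (Pa%:~R * r + Pb%:~R) * (c%:~R * r + d%:~R).
  by rewrite -sM -sP; ring.
(* The coefficients of r^2, r and 1 in [quad]. *)
have [e1 e2 e3] : [/\ a * Pc - c * Pa = 0,
    a * Pd + b * Pc - (Pa * d + Pb * c) = 0 & b * Pd - d * Pb = 0].
  apply: (cubic_root_free f4 f_irr fr).
  rewrite !(rmorphB, rmorphD) /= !rmorphM /=.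
  transitivity ((a%:~R * r + b%:~R) * (Pc%:~R * r + Pd%:~R) -
            (Pa%:~R * r + Pb%:~R) * (c%:~R * r + d%:~R)); first by ring.
  by rewrite quad subrr.
have [_ sprim _] := ss; have [_ tprim _] := tt.
have [l [PaE PbE PcE PdE]] := primitive_proportional sprim det0
  (subr0_eq e1) (subr0_eq e3) (subr0_eq e2).
(* P = l M, so l divides every entry of M' = U^-1 P, and M' is primitive. *)
have l2 : l ^+ 2 = 1.
  have : (l %| gcdz (gcdz a' b') (gcdz c' d'))%Z.
    rewrite !dvdz_gcd.
    have -> : a' = (A * D - B * C) * (D * Pa - B * Pc).
      by rewrite -[LHS]mul1r -det1 /Pa /Pc; ring.
    have -> : b' = (A * D - B * C) * (D * Pb - B * Pd).
      by rewrite -[LHS]mul1r -det1 /Pb /Pd; ring.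
    have -> : c' = (A * D - B * C) * (A * Pc - C * Pa).
      by rewrite -[LHS]mul1r -det1 /Pa /Pc; ring.
    have -> : d' = (A * D - B * C) * (A * Pd - C * Pb).
      by rewrite -[LHS]mul1r -det1 /Pb /Pd; ring.
    have dvdP u v x y : (l %| (A * D - B * C) * (u * (l * x) - v * (l * y)))%Z.
      by rewrite dvdz_mull // rpredB // dvdz_mull // dvdz_mulr.
    by rewrite PaE PbE PcE PdE !dvdP.
  by rewrite tprim dvdz1; case: (l) => [] [|[|]].
(* As l is its own inverse, M = l P = (l U) M'. *)
apply: (@unimodular_invariants (l * A) (l * B) (l * C) (l * D)).
- transitivity ((l ^+ 2) ^+ 2 * (A * D - B * C) ^+ 2); first by ring.
  by rewrite l2 det1.
- exact: gcdz_neq0_det det0.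
- by rewrite -[LHS]mul1r -l2 expr2 -mulrA -PaE /Pa; ring.
- by rewrite -[LHS]mul1r -l2 expr2 -mulrA -PbE /Pb; ring.
- by rewrite -[LHS]mul1r -l2 expr2 -mulrA -PcE /Pc; ring.
- by rewrite -[LHS]mul1r -l2 expr2 -mulrA -PdE /Pd; ring.
Qed.

(** Both numbers are replaced by their Hermite forms, whose entries agree except that the upper
    right ones are only congruent modulo eta and the lower right ones may differ in sign. An integer
    translation and a negation absorb these differences. *)
Lemma same_invariants_tail_equiv (R : realType) (r s t : R)
    (a b c d a' b' c' d' : int) :
  irrational r -> irrational s -> irrational t ->
  standard_form r s a b c d -> standard_form r t a' b' c' d' ->
  `|a * d - b * c| = `|a' * d' - b' * c'| -> gcdz a c = gcdz a' c' ->
  y_of a b c d = y_of a' b' c' d' -> tail_equiv s t.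
Proof.
move=> rirr sirr tirr ss tt detE gcdE.
have det0 := standard_form_det sirr ss; have e0 := gcdz_neq0_det det0.
have e0' : gcdz a' c' != 0 by rewrite -gcdE.
have [p [q /(bezoutz_div_gcdz e0) bez]] := Bezoutz a c.
have [p' [q' /(bezoutz_div_gcdz e0') bez']] := Bezoutz a' c'.
rewrite (y_ofE b d bez) (y_ofE b' d' bez') /eta_of /eps_of -detE -gcdE => yE.
apply: tail_equiv_trans (tail_equiv_sym (tail_equiv_hermite sirr ss bez)) _.
apply: tail_equiv_trans (tail_equiv_hermite tirr tt bez').
rewrite -gcdE; move: yE.
move: (p * b + q * d) (p' * b' + q' * d') => Y Y' /eqP; rewrite eqz_mod_dvd.
set e := gcdz a c in e0 *; set D := a * d - b * c in det0 detE *.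
set D' := a' * d' - b' * c' in detE *.
have eD : (e %| D)%Z.
  by rewrite rpredB //; [apply/dvdz_mulr/dvdz_gcdl | apply/dvdz_mull/dvdz_gcdr].
have /dvdzP[k DE] := eD.
have k0 : k != 0 by apply: contra_neq det0 => k0; rewrite DE k0 mul0r.
have e_norm : `|e| = e by [].
rewrite {1}DE normrM e_norm mulzK // DE mulzK //.
rewrite dvdzE -abszE absz_id -dvdzE => /dvdzP[m YE].
have kR0 : k%:~R != 0 :> R by rewrite intr_eq0.
(* eta is the absolute value of k, so equal y means that Y and Y' differ by a multiple m * k. *)
have zE : (e%:~R * r + Y%:~R) / k%:~R = (e%:~R * r + Y'%:~R) / k%:~R + m%:~R.
  have -> : Y = Y' + m * k by rewrite -YE addrC subrK.
  by rewrite rmorphD rmorphM /=; field.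
rewrite zE; apply: tail_equiv_trans (tail_equiv_addz _ _) _.
(* Only the absolute values of the determinants agree; the opposite sign negates the Hermite
   quotient. *)
have [->|->] : D' = k * e \/ D' = (- k) * e.
  move/eqP: detE; rewrite eqr_norm2 -eqr_oppLR mulNr -DE.
  by case/orP => /eqP <-; [left | right].
  by rewrite mulzK //; apply: tail_equiv_refl.
rewrite mulzK // rmorphN invrN mulrN; apply/tail_equiv_sym/tail_equiv_opp.
apply: (@irrational_mobius R r _ e Y' 0 k) => //.
  by rewrite mulr0 subr0 mulf_neq0.
by rewrite mul0r add0r divfK.
Qed.

Theorem theorem3p5 (R : realType) (f : {poly rat}) (r s t : R)
    (a b c d a' b' c' d' : int)
    (f_cubic : size f = 4%N)
    (f_irr : irreducible_poly f)
    (f_root : root (map_poly (@ratr R) f) r)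
    (s_irrational : irrational s)
    (t_irrational : irrational t)
    (s_std : standard_form r s a b c d)
    (t_std : standard_form r t a' b' c' d') :
  common_tails s t <->
  [/\ `|a * d - b * c| = `|a' * d' - b' * c'|,
      gcdz a c = gcdz a' c'
    & y_of a b c d = y_of a' b' c' d'].
Proof.
split; first exact: (common_tails_invariants f_cubic f_irr f_root).
move=> [detE gcdE yE]; apply: tail_equiv_common_tails.
have r_irrational := cubic_root_irrational f_cubic f_irr f_root.
exact: same_invariants_tail_equiv r_irrational s_irrational t_irrational
  s_std t_std detE gcdE yE.
Qed.
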